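(* For any real Banach space $X$, the Banach spaces $F(S_X)$ and $F^{ph}(X)$ are linearly homeomorphic, i.e. there is a bounded linear bijection between them with bounded inverse. Here $F(S_X)$ denotes the closed linear span of $\{\delta_x: x\in S_X\}$ in $Lip_0(S_X\cup\{0\})^*$.
   Context: $S_X$ is the unit sphere of $X$. For a pointed metric space $M$ with base point $0$, $Lip_0(M)$ is the Banach space of Lipschitz functions $f:M\to\mathbb{R}$ with $f(0)=0$, normed by the best Lipschitz constant $Lip(f)$; $\delta_x\in Lip_0(M)^*$ is evaluation at $x\in M$. The set $S_X\cup\{0\}$ carries the metric induced by the norm of $X$ and base point $0$. Thus $F(S_X)$ is the Lipschitz-free space of the pointed metric space $S_X\cup\{0\}$. $Lip_0^{ph}(X)=\{f\in Lip_0(X): f(\alpha x)=\alpha f(x)\ \forall\alpha\ge0,\ x\in X\}$ with norm $Lip(\cdot)$; for $x\in X$, $\delta_x^{ph}\in Lip_0^{ph}(X)^*$ is evaluation at $x$; and $F^{ph}(X)=\overline{\operatorname{span}}^{\|\cdot\|}\{\delta_x^{ph}:x\in X\}\subset Lip_0^{ph}(X)^*$. *)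

(* Defs.v *)
From HB Require Import structures.
From mathcomp Require Import all_boot all_order all_algebra.
From mathcomp Require Import boolp classical_sets functions reals topology.
From mathcomp Require Import normedtype.

Set Implicit Arguments.
Unset Strict Implicit.
Unset Printing Implicit Defensive.

Import Order.TTheory GRing.Theory Num.Theory.
Import numFieldNormedType.Exports.

Local Open Scope classical_set_scope.
Local Open Scope ring_scope.

(* [normedModType] does not inherit from [metricType] in the library, so the
   metric space underlying a normed space is an alias of it. *)
Definition metric_of (R : realType) (X : normedModType R) : Type := X.

Section MetricOf.
Context (R : realType) (X : normedModType R).

HB.instance Definition _ := PseudoMetric.copy (metric_of X) X.

Let dist (x y : metric_of X) : R := `|(x : X) - (y : X)|.

Let dist_ge0 x y : 0 <= dist x y.
Proof. exact: normr_ge0. Qed.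

Let dist_positivity x y : dist x y = 0 -> x = y.
Proof. by move/normr0_eq0/subr0_eq. Qed.

Let ball_dist (x : metric_of X) d : ball x d = [set y | dist x y < d].
Proof. by rewrite -[ball x d]/(@ball R X x d) -ball_normE. Qed.

HB.instance Definition _ := @PseudoMetric_isMetric.Build R (metric_of X)
  dist dist_ge0 dist_positivity ball_dist.

End MetricOf.

(* [set_type A] already carries the induced pseudometric structure in the
   library, but not the induced distance. *)
Section SubMetric.
Context (R : realType) (M : metricType R) (A : set M).

Let dist (x y : set_type A) : R := mdist (val x) (val y).

Let dist_ge0 x y : 0 <= dist x y.
Proof. exact: mdist_ge0. Qed.

Let dist_positivity x y : dist x y = 0 -> x = y.
Proof. by move/mdist_positivity/val_inj. Qed.

Let ball_dist (x : set_type A) d : ball x d = [set y | dist x y < d].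
Proof.
apply/funext => y; rewrite -[LHS]/(ball (val x) d (val y)).
by rewrite ballEmdist.
Qed.

HB.instance Definition _ := @PseudoMetric_isMetric.Build R (set_type A)
  dist dist_ge0 dist_positivity ball_dist.

End SubMetric.

(* The library has neither subspaces of a normed module as normed modules nor
   topological duals; the norm on [linsub_type V] is the restricted one. *)
Record linsub (R : realType) (E : normedModType R) := Linsub {
  linsub_set :> set E ;
  linsub_closed : submod_closed [pred x | x \in linsub_set] }.

Definition linsub_pred (R : realType) (E : normedModType R) (V : linsub E) :
  {pred E} := [pred x | x \in linsub_set V].

Record linsub_type (R : realType) (E : normedModType R) (V : linsub E) :=
  LinsubElt {
  linsub_val :> E ;
  linsub_valP : linsub_val \in linsub_pred V }.

Section LinsubNormed.
Context (R : realType) (E : normedModType R) (V : linsub E).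

HB.instance Definition _ :=
  GRing.isSubmodClosed.Build R E (linsub_pred V) (linsub_closed V).

HB.instance Definition _ := [isSub of linsub_type V for @linsub_val R E V].
HB.instance Definition _ := [Choice of linsub_type V by <:].
HB.instance Definition _ := [SubChoice_isSubLmodule of linsub_type V by <:].

Let nrm (x : linsub_type V) : R := `|val x|.

Let nrmD x y : nrm (x + y) <= nrm x + nrm y.
Proof. by rewrite /nrm raddfD ler_normD. Qed.

Let nrmZ (a : R) x : nrm (a *: x) = `|a| * nrm x.
Proof. by rewrite /nrm linearZ normrZ. Qed.

Let nrm0_eq0 x : nrm x = 0 -> x = 0.
Proof. by move/normr0_eq0 => x0; apply: val_inj; rewrite x0 raddf0. Qed.

HB.instance Definition _ := @Lmodule_isNormed.Build R (linsub_type V)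
  nrm nrmD nrmZ nrm0_eq0.

End LinsubNormed.

Section ClosedSpan.
Context (R : realType) (E : normedModType R).

Definition lin_span (A : set E) : set E :=
  [set v | exists (n : nat) (c : 'I_n -> R) (a : 'I_n -> E),
    (forall i, A (a i)) /\ v = \sum_(i < n) c i *: a i].

Lemma lin_span0 (A : set E) : lin_span A 0.
Proof.
exists 0%N, (fun=> 0), (fun=> 0); split; first by case.
by rewrite big_ord0.
Qed.

Lemma lin_spanP (A : set E) (l : R) (u v : E) :
  lin_span A u -> lin_span A v -> lin_span A (l *: u + v).
Proof.
move=> [n [c [a [Aa ->]]]] [m [d [b [Ab ->]]]].
exists (n + m)%N.
exists (fun i : 'I_(n + m) => match fintype.split i with inl j => l * c j | inr j => d j end).
exists (fun i : 'I_(n + m) => match fintype.split i with inl j => a j | inr j => b j end).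
split=> [i|]; first by case: (fintype.split i).
rewrite big_split_ord /= scaler_sumr; congr (_ + _); apply: eq_bigr => i _.
  by rewrite (unsplitK (inl i)) scalerA.
by rewrite (unsplitK (inr i)).
Qed.

Lemma closure_normP (A : set E) (x : E) :
  closure A x <-> forall e, 0 < e -> exists2 y, A y & `|x - y| < e.
Proof.
split=> [cAx e e0|Ax B /nbhs_ballP[e /= e0 eB]].
  have [y [Ay]] := cAx _ (nbhsx_ballx x e e0).
  by rewrite -ball_normE; exists y.
have [y Ay xy] := Ax e e0; exists y; split => //.
by apply: eB; rewrite -ball_normE.
Qed.

Lemma closed_span_closed (A : set E) :
  submod_closed [pred x | x \in closure (lin_span A)].
Proof.
split=> [|l u v]; rewrite !inE.
  exact/subset_closure/lin_span0.
move=> /closure_normP Au /closure_normP Av; apply/closure_normP => e e0.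
have k0 : 0 < `|l| + 1 by rewrite ltr_wpDl.
have [y Ay uy] := Au _ (divr_gt0 (divr_gt0 e0 (ltr0Sn _ 1)) k0).
have [z Az vz] := Av _ (divr_gt0 e0 (ltr0Sn _ 1)).
exists (l *: y + z); first exact: lin_spanP.
rewrite opprD addrACA -scalerBr (le_lt_trans (ler_normD _ _))//.
rewrite [e in _ < e]splitr ler_ltD// normrZ.
rewrite (@le_trans _ _ ((`|l| + 1) * `|u - y|))//.
  by rewrite ler_wpM2r// lerDl.
by rewrite mulrC -ler_pdivlMr// ltW.
Qed.

Definition closed_span (A : set E) : linsub E := Linsub (@closed_span_closed A).

End ClosedSpan.

Definition dual_pred (R : realType) (E : normedModType R) : {pred E -> R^o} :=
  [pred f : E -> R^o | `[< linear f /\ continuous f >]].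

Record dual (R : realType) (E : normedModType R) := Dual {
  dual_fun :> E -> R^o ;
  dualP : dual_fun \in @dual_pred R E }.

Section DualNormed.
Context (R : realType) (E : normedModType R).

HB.instance Definition _ := [isSub of dual E for @dual_fun R E].
HB.instance Definition _ := [Choice of dual E by <:].

Lemma dual_linear (phi : dual E) : linear phi.
Proof. by case/asboolP: (dualP phi). Qed.

Lemma dual_continuous (phi : dual E) : continuous phi.
Proof. by case/asboolP: (dualP phi). Qed.

Let dual_submod_closed : submod_closed (@dual_pred R E).
Proof.
split=> [|a f g].
  apply/asboolP; split=> [b x y|]; last exact: cst_continuous.
  by rewrite /= scaler0 addr0.
move=> /asboolP[lf cf] /asboolP[lg cg]; apply/asboolP; split=> [b x y|x].
  rewrite !fctE lf lg !scalerDr !scalerA mulrC.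
  by rewrite -!addrA; congr (_ + _); rewrite addrCA.
apply: (@cvgD _ R^o); last exact: cg.
by apply: (@cvgZl_tmp _ R^o); exact: cf.
Qed.

HB.instance Definition _ :=
  GRing.isSubmodClosed.Build R (E -> R^o) (@dual_pred R E) dual_submod_closed.
HB.instance Definition _ := [SubChoice_isSubLmodule of dual E by <:].

HB.instance Definition _ (phi : dual E) :=
  @GRing.isLinear.Build R E R^o *:%R (dual_fun phi) (dual_linear phi).

Definition op_norm (phi : dual E) : R :=
  sup [set `|phi x| | x in [set x : E | `|x| <= 1]].

Lemma op_norm_has_sup (phi : dual E) :
  has_sup [set `|phi x| | x in [set x : E | `|x| <= 1]].
Proof.
split; first by exists `|phi 0|, 0 => //=; rewrite normr0.
have /linear_bounded_continuous/linear_boundedP/pinfty_ex_gt0[r r0 phir] :=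
  @dual_continuous phi.
exists r => _ [x /= x1 <-]; rewrite (le_trans (phir x))//.
by rewrite ler_piMr// ltW.
Qed.

Lemma op_norm_ge0 (phi : dual E) : 0 <= op_norm phi.
Proof.
apply: (@le_trans _ _ `|phi 0|) => //.
apply: ub_le_sup; first by case: (op_norm_has_sup phi).
by exists 0 => //=; rewrite normr0.
Qed.

Lemma op_normP (phi : dual E) x : `|phi x| <= op_norm phi * `|x|.
Proof.
have [->|x0] := eqVneq x 0; first by rewrite linear0 !normr0 mulr0.
have nx0 : 0 < `|x| by rewrite normr_gt0.
rewrite -ler_pdivrMr//; apply: ub_le_sup; first by case: (op_norm_has_sup phi).
exists (`|x|^-1 *: x) => /=.
  by rewrite normrZ gtr0_norm ?invr_gt0// mulVf ?gt_eqF.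
by rewrite linearZ/= normrZ gtr0_norm ?invr_gt0// mulrC.
Qed.

Lemma op_norm_le (phi : dual E) (C : R) :
  (forall x, `|x| <= 1 -> `|phi x| <= C) -> op_norm phi <= C.
Proof.
move=> phiC; apply: ge_sup => [|_ [x /= x1 <-]]; last exact: phiC.
by case: (op_norm_has_sup phi).
Qed.

Let op_normD phi psi : op_norm (phi + psi) <= op_norm phi + op_norm psi.
Proof.
apply: op_norm_le => x x1; rewrite (le_trans (ler_normD _ _))//.
by rewrite lerD//; apply: (le_trans (op_normP _ _)); rewrite ler_piMr// op_norm_ge0.
Qed.

Let op_norm0_eq0 phi : op_norm phi = 0 -> phi = 0.
Proof.
move=> phi0; apply/val_inj/funext => x.
by have := op_normP phi x; rewrite phi0 mul0r normr_le0 => /eqP.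
Qed.

Let op_normZ_le (a : R) phi : op_norm (a *: phi) <= `|a| * op_norm phi.
Proof.
apply: op_norm_le => x x1; rewrite [leLHS]normrZ ler_wpM2l//.
by apply: (le_trans (op_normP _ _)); rewrite ler_piMr// op_norm_ge0.
Qed.

Let op_normZ (a : R) phi : op_norm (a *: phi) = `|a| * op_norm phi.
Proof.
apply/eqP; rewrite eq_le op_normZ_le/=.
have [->|a0] := eqVneq a 0; first by rewrite normr0 mul0r op_norm_ge0.
rewrite mulrC -ler_pdivlMr ?normr_gt0// mulrC -normfV.
by rewrite -[phi in leLHS](scalerK a0) op_normZ_le.
Qed.

HB.instance Definition _ := @Lmodule_isNormed.Build R (dual E)
  op_norm op_normD op_normZ op_norm0_eq0.

End DualNormed.

Definition lip_consts (R : realType) (M : metricType R) (f : M -> R) : set R :=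
  [set K | 0 <= K /\ forall x y, `|f x - f y| <= K * mdist x y].

Definition lip0_pred (R : realType) (M : metricType R) (o : M) :
  {pred M -> R^o} := [pred f : M -> R^o | `[< f o = 0 /\ lip_consts f !=set0 >]].

Record Lip0 (R : realType) (M : metricType R) (o : M) := MkLip0 {
  lip0_fun :> M -> R^o ;
  lip0P : lip0_fun \in lip0_pred o }.

Section Lip0Normed.
Context (R : realType) (M : metricType R) (o : M).

HB.instance Definition _ := [isSub of Lip0 o for @lip0_fun R M o].
HB.instance Definition _ := [Choice of Lip0 o by <:].

Let lip_constsD (f g : M -> R^o) K L :
  lip_consts f K -> lip_consts g L -> lip_consts (f \+ g) (K + L).
Proof.
move=> [K0 fK] [L0 gL]; split=> [|x y]; first exact: addr_ge0.
by rewrite /= opprD addrACA (le_trans (ler_normD _ _))// mulrDl lerD.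
Qed.

Let lip_constsZ (a : R) (f : M -> R^o) K :
  lip_consts f K -> lip_consts (fun x => a *: f x) (`|a| * K).
Proof.
move=> [K0 fK]; split=> [|x y]; first exact: mulr_ge0.
by rewrite /= -scalerBr normrZ -mulrA ler_wpM2l.
Qed.

Let lip0_submod_closed : submod_closed (lip0_pred o).
Proof.
split=> [|a f g].
  apply/asboolP; split=> //; exists 0; split=> // x y.
  by rewrite subrr normr0 mul0r.
move=> /asboolP[f0 [K fK]] /asboolP[g0 [L gL]]; apply/asboolP; split.
  by rewrite !fctE f0 g0 scaler0 addr0.
exists (`|a| * K + L).
exact: (lip_constsD (lip_constsZ a fK) gL).
Qed.

HB.instance Definition _ :=
  GRing.isSubmodClosed.Build R (M -> R^o) (lip0_pred o) lip0_submod_closed.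
HB.instance Definition _ := [SubChoice_isSubLmodule of Lip0 o by <:].

Definition lip_norm (f : Lip0 o) : R := inf (lip_consts f).

Lemma lip0_base (f : Lip0 o) : f o = 0.
Proof. by case/asboolP: (lip0P f). Qed.

Lemma lip_consts_neq0 (f : Lip0 o) : lip_consts f !=set0.
Proof. by case/asboolP: (lip0P f). Qed.

Lemma lip_norm_ge0 (f : Lip0 o) : 0 <= lip_norm f.
Proof. by apply: lb_le_inf => [|K []//]; exact: lip_consts_neq0. Qed.

Lemma lip_norm_le (f : Lip0 o) K : lip_consts f K -> lip_norm f <= K.
Proof. by apply: ge_inf; exists 0 => ? []. Qed.

Lemma lip_normP (f : Lip0 o) : lip_consts f (lip_norm f).
Proof.
split=> [|x y]; first exact: lip_norm_ge0.
have [->|xy] := eqVneq x y; first by rewrite subrr normr0 mdistxx mulr0.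
have d0 : 0 < mdist x y by rewrite mdist_gt0.
rewrite -ler_pdivrMr//; apply: lb_le_inf => [|K [_ fK]].
  exact: lip_consts_neq0.
by rewrite ler_pdivrMr.
Qed.

Let lip_normD f g : lip_norm (f + g) <= lip_norm f + lip_norm g.
Proof. by apply: lip_norm_le; apply: lip_constsD; exact: lip_normP. Qed.

Let lip_normZ_le (a : R) f : lip_norm (a *: f) <= `|a| * lip_norm f.
Proof. by apply: lip_norm_le; apply: lip_constsZ; exact: lip_normP. Qed.

Let lip_normZ (a : R) f : lip_norm (a *: f) = `|a| * lip_norm f.
Proof.
apply/eqP; rewrite eq_le lip_normZ_le/=.
have [->|a0] := eqVneq a 0; first by rewrite normr0 mul0r lip_norm_ge0.
rewrite mulrC -ler_pdivlMr ?normr_gt0// mulrC -normfV.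
by rewrite -[f in leLHS](scalerK a0) lip_normZ_le.
Qed.

Let lip_norm0_eq0 f : lip_norm f = 0 -> f = 0.
Proof.
move=> f0; apply/val_inj/funext => x.
have [_ /(_ x o)] := lip_normP f.
by rewrite f0 mul0r lip0_base subr0 normr_le0 => /eqP.
Qed.

HB.instance Definition _ := @Lmodule_isNormed.Build R (Lip0 o)
  lip_norm lip_normD lip_normZ lip_norm0_eq0.

Lemma lip0_le (f : Lip0 o) x : `|f x| <= `|f| * mdist x o.
Proof. by have [_ /(_ x o)] := lip_normP f; rewrite lip0_base subr0. Qed.

End Lip0Normed.

Section BoundedFunctional.
Context (R : realType) (E : normedModType R).

Lemma bounded_dual_pred (f : E -> R^o) (K : R) :
  linear f -> (forall x, `|f x| <= K * `|x|) -> f \in @dual_pred R E.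
Proof.
move=> lf fK; apply/asboolP; split=> //.
pose F : {linear E -> R^o} :=
  HB.pack f (@GRing.isLinear.Build R E R^o *:%R f lf).
apply: (@bounded_linear_continuous _ _ _ F); apply/linear_boundedP.
near=> r => x; rewrite (le_trans (fK x))// ler_wpM2r//.
by near: r; apply: nbhs_pinfty_ge; rewrite num_real.
Unshelve. all: by end_near. Qed.

End BoundedFunctional.

Section FreeSpace.
Context (R : realType) (M : metricType R) (o : M).

Let eval_dual (x : M) : (fun f : Lip0 o => f x : R^o) \in @dual_pred R (Lip0 o).
Proof.
apply: (@bounded_dual_pred _ _ _ (mdist x o)) => [//|f].
by rewrite mulrC lip0_le.
Qed.

Definition delta (x : M) : dual (Lip0 o) := Dual (eval_dual x).

End FreeSpace.

Section SphereFreeSpace.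
Context (R : realType) (X : normedModType R).

Definition sphere0_set : set (metric_of X) :=
  [set x | `|x : X| = 1 \/ (x : X) = 0].

Definition sphere0 : metricType R := set_type sphere0_set.

Let zero_sphere0 : (0 : X) \in sphere0_set.
Proof. by rewrite inE; right. Qed.

Definition sphere0_base : sphere0 := exist _ (0 : X) zero_sphere0.

Definition free_sphere_sub : linsub (dual (Lip0 sphere0_base)) :=
  closed_span [set delta sphere0_base x | x in
    [set x : sphere0 | `|val x : X| = 1]].

Definition free_sphere : normedModType R := linsub_type free_sphere_sub.

End SphereFreeSpace.

Section PosHomFreeSpace.
Context (R : realType) (X : normedModType R).

Definition origin : metric_of X := (0 : X).

Definition Lip0X : normedModType R := Lip0 origin.

Definition lip0ph_set : set Lip0X := [set f : Lip0X |
  forall (a : R) (x : X), 0 <= a -> f (a *: x) = a * f x].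

Let lip0ph_closed : submod_closed [pred f | f \in lip0ph_set].
Proof.
split=> [|b f g].
  by apply/mem_set => a x _; rewrite /= mulr0.
move=> /set_mem fph /set_mem gph; apply/mem_set => a x a0.
rewrite -[LHS]/(b * f (a *: x) + g (a *: x)).
by rewrite fph// gph// mulrCA -mulrDr.
Qed.

Definition lip0ph_sub : linsub Lip0X := Linsub lip0ph_closed.

Definition Lip0ph : normedModType R := linsub_type lip0ph_sub.

Let eval_ph_dual (x : X) :
  (fun f : Lip0ph => (val f : Lip0X) x : R^o) \in @dual_pred R Lip0ph.
Proof.
apply: (@bounded_dual_pred _ _ _ (mdist (x : metric_of X) origin)) => [//|f].
by rewrite mulrC; exact: lip0_le.
Qed.

Definition delta_ph (x : X) : dual Lip0ph := Dual (eval_ph_dual x).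

Definition free_ph_sub : linsub (dual Lip0ph) :=
  closed_span [set delta_ph x | x in [set: X]].

Definition free_ph : normedModType R := linsub_type free_ph_sub.

End PosHomFreeSpace.

Definition bounded_op (R : realType) (E F : normedModType R) (T : E -> F) :=
  exists C : R, forall x, `|T x| <= C * `|x|.

Definition linearly_homeomorphic (R : realType) (E F : normedModType R) :=
  exists (T : {linear E -> F}) (S : F -> E),
    [/\ cancel T S, cancel S T, bounded_op T & bounded_op S].

(* Main.v *)
(* Restriction to the sphere and positively homogeneous extension
   f |-> (x |-> |x| f(x/|x|)) are mutually inverse bounded linear maps between
   Lip_0^ph(X) and Lip_0(S_X u {0}).  Their transposes are therefore mutually
   inverse bounded operators between the duals, and they send delta_x to
   delta_x^ph, respectively delta_x^ph to |x| delta_(x/|x|), so that they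
   exchange the closed spans of these families. *)
Require Import Defs.
From HB Require Import structures.
From mathcomp Require Import all_boot all_order all_algebra.
From mathcomp Require Import boolp classical_sets reals topology.
From mathcomp Require Import normedtype.

Set Implicit Arguments.
Unset Strict Implicit.
Unset Printing Implicit Defensive.

Import Order.TTheory GRing.Theory Num.Theory.
Import numFieldNormedType.Exports.

Local Open Scope classical_set_scope.
Local Open Scope ring_scope.

(** * Bounded operators acting on closed linear spans *)

Section ClosedSpanMap.
Context (R : realType).

Lemma lin_span_image (E F : normedModType R) (T : {linear E -> F})
    (A : set E) (B : set F) :
  (forall x, A x -> lin_span B (T x)) ->
  forall x, lin_span A x -> lin_span B (T x).
Proof.
move=> TA _ [n [c [a [Aa ->]]]]; rewrite linear_sum.
elim/big_ind: _ => [|u v Bu Bv|i _]; first exact: lin_span0.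
  by rewrite -[u]scale1r; exact: lin_spanP.
by rewrite linearZ/= -[_ *: _]addr0; apply: lin_spanP (TA _ _) (lin_span0 B).
Qed.

(** By linearity [T] maps the span of [A] into that of [B], and by boundedness it carries
    approximations to approximations. *)
Lemma closed_span_image (E F : normedModType R) (T : {linear E -> F})
    (A : set E) (B : set F) : bounded_op T ->
  (forall x, A x -> lin_span B (T x)) ->
  forall x, x \in linsub_pred (closed_span A) ->
  T x \in linsub_pred (closed_span B).
Proof.
move=> [C TC] TA x; rewrite !inE => /closure_normP Ax.
apply/closure_normP => e e0.
(* [C] may be zero or negative, so the tolerance is [e] divided by the positive number [|C| + 1]. *)
have k0 : 0 < `|C| + 1 by rewrite ltr_wpDl.
have [y Ay xy] := Ax _ (divr_gt0 e0 k0).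
exists (T y); first exact: lin_span_image Ay.
rewrite -linearB (le_lt_trans (TC _))//.
rewrite (@le_lt_trans _ _ ((`|C| + 1) * `|x - y|))//.
  by rewrite ler_wpM2r// (le_trans (ler_norm C))// lerDl.
by rewrite mulrC -ltr_pdivlMr.
Qed.

(** Each operator restricts to the closed spans, and the restrictions stay mutually inverse.
    Generators need only land in the span of the others, which leaves room for scalar factors and
    for zero. *)
Lemma closed_span_homeo (E F : normedModType R) (T : {linear E -> F})
    (S : {linear F -> E}) (A : set E) (B : set F) :
  cancel T S -> cancel S T -> bounded_op T -> bounded_op S ->
  (forall x, A x -> lin_span B (T x)) ->
  (forall y, B y -> lin_span A (S y)) ->
  linearly_homeomorphic (linsub_type (closed_span A))
    (linsub_type (closed_span B)).
Proof.
move=> TK SK bT bS TA SB.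
pose t (x : linsub_type (closed_span A)) : linsub_type (closed_span B) :=
  LinsubElt (closed_span_image bT TA (linsub_valP x)).
pose s (y : linsub_type (closed_span B)) : linsub_type (closed_span A) :=
  LinsubElt (closed_span_image bS SB (linsub_valP y)).
have t_lin : linear t by move=> a x y; apply/val_inj; exact: linearP.
pose tL : {linear _ -> _} := HB.pack t (GRing.isLinear.Build R _ _ _ t t_lin).
exists tL, s; split=> [x|y||].
- by apply/val_inj; exact: TK.
- by apply/val_inj; exact: SK.
- by have [C TC] := bT; exists C => x; exact: TC.
- by have [C SC] := bS; exists C => y; exact: SC.
Qed.

End ClosedSpanMap.

(** * Transposes of bounded operators *)

Section Transpose.
Context (R : realType) (E F : normedModType R) (g : {linear E -> F}).
Hypothesis bg : bounded_op g.

Let transpose_dual (phi : dual F) : (phi \o g : E -> R^o) \in @dual_pred R E.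
Proof.
have [C gC] := bg; apply: (@bounded_dual_pred _ _ _ (op_norm phi * C)).
  by move=> a x y; rewrite /= linearP linearP.
move=> x; rewrite (le_trans (op_normP _ _))// -mulrA.
by rewrite ler_wpM2l// op_norm_ge0.
Qed.

Definition transpose (phi : dual F) : dual E := Dual (transpose_dual phi).

Let transpose_linear : linear transpose.
Proof. by move=> a phi psi; apply/val_inj. Qed.

HB.instance Definition _ :=
  GRing.isLinear.Build R (dual F) (dual E) _ transpose transpose_linear.

Lemma transpose_bounded : bounded_op transpose.
Proof.
have [C gC] := bg; exists `|C| => phi.
rewrite -[`|phi|]/(op_norm phi); apply: op_norm_le => x x1.
rewrite -[transpose phi x]/(phi (g x)) (le_trans (op_normP _ _))//.
rewrite mulrC ler_wpM2r ?op_norm_ge0//.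
rewrite (le_trans (gC x))// (@le_trans _ _ (`|C| * `|x|))//.
  by rewrite ler_wpM2r// ler_norm.
by rewrite ler_piMr.
Qed.

End Transpose.

Lemma lip0_linearE (R : realType) (M : metricType R) (o : M) (a : R)
    (f g : Lip0 o) (x : M) :
  (a *: f + g) x = a * f x + g x.
Proof. by []. Qed.

(** * Restriction to the sphere and positively homogeneous extension *)

Section SphereRestrictionExtension.
Context (R : realType) (X : normedModType R).

Local Notation LipS := (Lip0 (sphere0_base X)).
Local Notation Lipph := (Lip0ph X).

Let restrict_lip0 (f : Lipph) :
  (fun x : sphere0 X => (val f : Lip0X X) (val x) : R^o)
    \in lip0_pred (sphere0_base X).
Proof.
apply/asboolP; split; first exact: (lip0_base (val f)).
exists (lip_norm (val f)); have [f0 fL] := lip_normP (val f).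
by split=> // x y; exact: fL.
Qed.

Definition restrict (f : Lipph) : LipS := MkLip0 (restrict_lip0 f).

Lemma restrictE (f : Lipph) (s : sphere0 X) :
  restrict f s = (val f : Lip0X X) (val s).
Proof. by []. Qed.

Let restrict_linear : linear restrict.
Proof.
move=> a f g; apply/val_inj/funext => s.
rewrite [RHS]lip0_linearE !restrictE -lip0_linearE.
have <- : val (a *: f + g) = a *: val f + val g by exact: linearP.
by [].
Qed.

HB.instance Definition _ :=
  GRing.isLinear.Build R Lipph LipS _ restrict restrict_linear.

Lemma restrict_bounded : bounded_op restrict.
Proof.
exists 1 => f; rewrite mul1r; apply: lip_norm_le.
have [f0 fL] := lip_normP (val f).
by split=> // x y; exact: fL.
Qed.

(* The junk value 0^-1 = 0 makes the direction of 0 the base point. *)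
Lemma direction_sphere0 (x : X) : `|x|^-1 *: x \in @sphere0_set R X.
Proof.
rewrite inE; have [->|x0] := eqVneq x 0; first by right; rewrite scaler0.
by left; rewrite normrZ normfV normr_id mulVf ?normr_eq0.
Qed.

Definition direction (x : X) : sphere0 X :=
  exist _ (`|x|^-1 *: x : metric_of X) (direction_sphere0 x).

Lemma direction_sphere (s : sphere0 X) :
  `|val s : X| = 1 -> direction (val s) = s.
Proof. by move=> s1; apply/val_inj; rewrite /= s1 invr1 scale1r. Qed.

Lemma scale_direction (x : X) : `|x| *: (val (direction x) : X) = x.
Proof.
have [->|x0] := eqVneq x 0; first by rewrite normr0 scale0r.
by rewrite /= scalerA mulfV ?normr_eq0// scale1r.
Qed.

Lemma norm_direction_le1 (x : X) : `|val (direction x) : X| <= 1.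
Proof. by case/set_mem: (valP (direction x)) => ->; rewrite ?normr0. Qed.

(** With [u] the direction of [x], the vector [|y| u - y] equals [(|y| - |x|) u + (x - y)]. Both
    summands have norm at most [|x - y|], since [|u| <= 1]. *)
Lemma mdist_direction (x y : X) :
  `|y| * mdist (direction x) (direction y) <= 2 * `|x - y|.
Proof.
rewrite -[mdist _ _]/`|(val (direction x) : X) - val (direction y)|.
rewrite -[in leLHS](normr_id y) -normrZ scalerBr scale_direction.
rewrite mulr_natl mulr2n -[X in X - y](subrK x) -addrA.
rewrite (le_trans (ler_normD _ _))// lerD//.
rewrite -[X in _ - X]scale_direction -scalerBl normrZ.
rewrite (@le_trans _ _ `| `|y| - `|x| |)//.
  by rewrite ler_piMr// norm_direction_le1.
by rewrite distrC ler_dist_dist.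
Qed.

Definition homogenize (f : sphere0 X -> R) (x : X) : R :=
  `|x| * f (direction x).

Lemma homogenize_lip (f : LipS) (x y : X) :
  `|homogenize f x - homogenize f y| <= 3 * lip_norm f * `|x - y|.
Proof.
have [L0 fL] := lip_normP f.
(* [f] vanishes at the base point, and every direction is within distance 1 of it. *)
have fx1 : `|f (direction x)| <= lip_norm f.
  rewrite (le_trans (lip0_le f _))// ler_piMr//.
  rewrite -[mdist _ _]/`|(val (direction x) : X) - 0| subr0.
  exact: norm_direction_le1.
(* The first summand varies the radius and costs one Lipschitz constant; the second varies the
   direction and costs two by [mdist_direction]. Hence the factor 3. *)
have -> : homogenize f x - homogenize f y =
    (`|x| - `|y|) * f (direction x) +
    `|y| * (f (direction x) - f (direction y)).
  by rewrite /homogenize mulrBl mulrBr addrA subrK.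
rewrite (le_trans (ler_normD _ _))// !normrM normr_id.
rewrite -[3]/(1 + 2)%:R natrD 2!mulrDl mul1r; apply: lerD.
  by rewrite mulrC ler_pM// ler_dist_dist.
rewrite -mulrA mulrCA.
apply: le_trans (ler_wpM2l (normr_ge0 y) (fL (direction x) (direction y))) _.
by rewrite [leLHS]mulrCA ler_wpM2l// mdist_direction.
Qed.

Lemma homogenize_ph (f : sphere0 X -> R) (a : R) (x : X) :
  0 <= a -> homogenize f (a *: x) = a * homogenize f x.
Proof.
(* The case [a = 0] is separate: only a positive factor preserves the direction of [x]. *)
rewrite /homogenize normrZ le_eqVlt => /predU1P[<-|a0].
  by rewrite normr0 !mul0r.
rewrite gtr0_norm// -mulrA; congr (_ * (_ * f _)); apply/val_inj => /=.
by rewrite normrZ gtr0_norm// scalerA invfM mulrAC mulVf ?mul1r ?gt_eqF.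
Qed.

Lemma homogenize_lip_consts (f : LipS) :
  @lip_consts R (metric_of X) (homogenize f) (3 * lip_norm f).
Proof.
split=> [|x y]; last exact: homogenize_lip.
by rewrite mulr_ge0// lip_norm_ge0.
Qed.

Let extend_lip0 (f : LipS) :
  (homogenize f : metric_of X -> R^o) \in lip0_pred (origin X).
Proof.
apply/asboolP; split; first by rewrite /homogenize normr0 mul0r.
by exists (3 * lip_norm f); exact: homogenize_lip_consts.
Qed.

Let extend_ph (f : LipS) :
  (MkLip0 (extend_lip0 f) : Lip0X X) \in linsub_pred (lip0ph_sub X).
Proof.
apply: (@mem_set _ (@lip0ph_set R X)) => a x; exact: homogenize_ph.
Qed.

Definition extend (f : LipS) : Lipph := LinsubElt (extend_ph f).

Let extend_linear : linear extend.
Proof.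
move=> a f g; apply/val_inj/val_inj/funext => x.
rewrite -[LHS]/(`|x| * (a * f (direction x) + g (direction x))).
by rewrite mulrDr mulrCA.
Qed.

HB.instance Definition _ :=
  GRing.isLinear.Build R LipS Lipph _ extend extend_linear.

Lemma extend_bounded : bounded_op extend.
Proof. by exists 3 => f; exact/lip_norm_le/homogenize_lip_consts. Qed.

Lemma extendK : cancel extend restrict.
Proof.
move=> f; apply/val_inj/funext => s.
rewrite -[LHS]/(`|val s : X| * f (direction (val s))).
have [s1|s0] := set_mem (valP s).
  by rewrite s1 mul1r direction_sphere.
(* The only point off the unit sphere is the base point, where both functions vanish. *)
have -> : s = sphere0_base X by exact/val_inj.
by rewrite /= normr0 mul0r lip0_base.
Qed.

(** Positive homogeneity with scalar [|x|] recovers [f x] from the value of [f] at the direction of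
    [x]. *)
Lemma restrictK : cancel restrict extend.
Proof.
move=> f; apply/val_inj/val_inj/funext => x.
rewrite -[LHS]/(`|x| * (val f : Lip0X X) (val (direction x))).
have /set_mem fph := linsub_valP f.
by rewrite -fph// scale_direction.
Qed.

Lemma transpose_restrict_delta (s : sphere0 X) :
  transpose restrict_bounded (delta (sphere0_base X) s) = delta_ph (val s).
Proof. exact/val_inj. Qed.

Lemma transpose_extend_delta (x : X) :
  transpose extend_bounded (delta_ph x) =
  `|x| *: delta (sphere0_base X) (direction x).
Proof. exact/val_inj. Qed.

End SphereRestrictionExtension.

Theorem proposition3p7 (R : realType) (X : completeNormedModType R) :
  linearly_homeomorphic (free_sphere X) (free_ph X).
Proof.
apply: (@closed_span_homeo R _ _ (transpose (@restrict_bounded R X))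
  (transpose (@extend_bounded R X))).
(* Transposition reverses composition, so this composite is precomposition with [restrict] after
   [extend]. *)
- by move=> phi; apply/val_inj/funext => f; rewrite /= extendK.
- by move=> phi; apply/val_inj/funext => f; rewrite /= restrictK.
- exact: transpose_bounded.
- exact: transpose_bounded.
- move=> _ [s _ <-]; exists 1%N, (fun=> 1), (fun=> delta_ph (val s)).
  split=> [_|]; first by exists (val s).
  by rewrite big_ord1 scale1r -transpose_restrict_delta.
- move=> _ [x _ <-]; rewrite [X in lin_span _ X]transpose_extend_delta.
  (* The direction of 0 is the base point, whose evaluation is not among the generators; there the
     image is the zero functional, which lies in any span. *)
  have [->|x0] := eqVneq x 0.
    by rewrite normr0 scale0r; exact: lin_span0.
  exists 1%N, (fun=> `|x|), (fun=> delta (sphere0_base X) (direction x)).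
  split=> [_|]; last by rewrite big_ord1.
  exists (direction x) => //=.
  by rewrite normrZ normfV normr_id mulVf ?normr_eq0.
Qed.
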